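(* Let $\mathcal{T}=(X,\mathit{init},\mathit{step})$ be an STS, let $\varphi=\forall\pi_1:\xi_1.\cdots\forall\pi_k:\xi_k.\,\phi$ be an OHyperLTL formula, let $\mathcal{A}_\phi=(Q_\phi,q_{\phi,0},\delta_\phi,B_\phi)$ be a deterministic symbolic safety automaton for $\phi$, and let $\mathcal{P}=\{p_1,\dots,p_n\}$ be a finite set of relational predicates such that every edge formula of $\mathcal{A}_\phi$ and every formula $\mathit{init}_{\langle\pi_i\rangle}$ and $(\xi_i)_{\langle\pi_i\rangle}$ ($1\le i\le k$) is expressible in $\mathcal{P}$. If player $\mathtt{SAFE}$ wins the safety game $\mathcal{G}_\forall(\mathcal{T},\varphi,\mathcal{P})$, then $\mathcal{T}\models\varphi$.
   Context: Fixed background first-order theory. An STS is $\mathcal{T}=(X,\mathit{init},\mathit{step})$, $X$ a finite set of variables, $\mathit{init}$ a formula over $X$, $\mathit{step}$ a formula over $X\uplus X'$ ($X'=\{x'\mid x\in X\}$). Traces of $\mathcal{T}$: infinite sequences $\mu_0\mu_1\cdots$ of assignments to $X$ with $\mu_0\models\mathit{init}$ and $\mu_i\uplus\mu'_{i+1}\models\mathit{step}$ (where $\mu'(x')=\mu(x)$); $\mathit{Traces}(\mathcal{T})$ is their set. Trace variables $\pi_1,\dots,\pi_k$; $X_\pi=\{x_\pi\mid x\in X\}$, $\vec X=X_{\pi_1}\cup\dots\cup X_{\pi_k}$, $\vec X'=X'_{\pi_1}\cup\dots\cup X'_{\pi_k}$ with $X'_\pi=\{x'_\pi\mid x\in X\}$.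 For a formula $\theta$ over $X$, $\theta_{\langle\pi\rangle}$ replaces each $x$ by $x_\pi$; for a formula $\theta$ over $\vec X$, $\theta^{\langle'\rangle}$ replaces each $x_\pi$ by $x'_\pi$. OHyperLTL: $\phi$ is an LTL-like formula built from atoms $\theta$ (formulas over $\vec X$) with $\neg,\wedge,\mathsf{X},\mathsf{U}$; for a trace assignment $\Pi$ (map from trace variables to traces over $X$), $\Pi(i)$ is the assignment to $\vec X$ with $\Pi(i)(x_\pi)=\Pi(\pi)(i)(x)$, and $\Pi,i\models\theta$ iff $\Pi(i)\models\theta$, $\Pi,i\models\mathsf X\phi$ iff $\Pi,i+1\models\phi$, $\Pi,i\models\phi_1\mathsf U\phi_2$ iff $\exists j\ge i$ with $\Pi,j\models\phi_2$ and $\Pi,m\models\phi_1$ for $i\le m<j$. For an observation formula $\xi$ over $X$ and trace $t$, $\mathit{valid}(t,\xi)$ iff $t(i)\models\xi$ for infinitely many $i$, and then $t|_\xi(i)=t(j)$ for $j$ the $i$-th index with $t(j)\models\xi$. $\mathcal{T}\models\forall\pi_1:\xi_1\cdots\forall\pi_k:\xi_k.\phi$ iff for all $t_1,\dots,t_k\in\mathit{Traces}(\mathcal{T})$ with $\mathit{valid}(t_i,\xi_i)$ for all $i$, $[\pi_1\mapsto t_1|_{\xi_1},\dots,\pi_k\mapsto t_k|_{\xi_k}],0\models\phi$. A symbolic safety automaton is $\mathcal{A}=(Q,q_0,\delta,B)$ with finite $Q$, $B\subseteq Q$, and $\delta$ a finite set of edges $(q,\theta,q')$, $\theta$ a formula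 over $\vec X$. A run on a sequence $w$ of assignments to $\vec X$ is $q_0q_1\cdots$ with, for each $i$, an edge $(q_i,\theta_i,q_{i+1})\in\delta$ with $w(i)\models\theta_i$; $w$ is accepted iff no run visits $B$. $\mathcal{A}$ is deterministic if for every $q$ and every assignment $\mu$ to $\vec X$ exactly one edge $(q,\theta,q')$ has $\mu\models\theta$. $\mathcal{A}_\phi$ is a safety automaton for $\phi$ if it accepts $\Pi(0)\Pi(1)\cdots$ exactly when $\Pi,0\models\phi$. A relational predicate is a formula over $\vec X$; a formula is expressible in $\mathcal{P}$ if equivalent to a Boolean combination of predicates in $\mathcal{P}$. Abstract states are $\hat s\in\mathbb{B}^n$; $\mathit{pred}(\hat s)=\bigwedge_{i=1}^n(p_i$ if $\hat s[i]=\top$, else $\neg p_i)$. For $M\subseteq\{\pi_1,\dots,\pi_k\}$, $\mathit{step}_M=\bigwedge_{i=1}^k(\mathit{step}_{\langle\pi_i\rangle}$ if $\pi_i\in M$, else $\bigwedge_{x\in X}x'_{\pi_i}=x_{\pi_i})$, where $\mathit{step}_{\langle\pi_i\rangle}$ renames $x$ to $x_{\pi_i}$ and $x'$ to $x'_{\pi_i}$. $\hat s_1\xrightarrow{M}\hat s_2$ iff $\mathit{pred}(\hat s_1)\wedge\mathit{pred}(\hat s_2)^{\langle'\rangle}\wedge\mathit{step}_M$ is satisfiable. $\mathit{obs}(\hat s)\in\mathbb{B}^k$ with $\mathit{obs}(\hat s)[i]=\top$ iff $\mathit{pred}(\hat s)\wedge(\xi_i)_{\langle\pi_i\rangle}$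 is satisfiable. $\delta_\phi(q,\hat s)$ is the unique $q'$ with an edge $(q,\theta,q')\in\delta_\phi$ such that $\mathit{pred}(\hat s)\wedge\theta$ is satisfiable. A safety game is $(S_{\mathtt{SAFE}},S_{\mathtt{REACH}},S_0,T,B)$ with states $S=S_{\mathtt{SAFE}}\uplus S_{\mathtt{REACH}}$, initial states $S_0$, transitions $T\subseteq S\times S$, bad states $B$. Plays are infinite paths from $S_0$; a positional strategy for player $p$ maps each $s\in S_p$ to a $T$-successor; $\mathtt{SAFE}$ wins if it has a strategy $\sigma$ such that no $\sigma$-compatible play (from any initial state) visits $B$. The game $\mathcal{G}_\forall(\mathcal{T},\varphi,\mathcal{P})$: $\mathtt{SAFE}$-states are $(\hat s,q,b)$ with $\hat s\in\mathbb{B}^n$, $q\in Q_\phi$, $b\in\mathbb{B}^k$; $\mathtt{REACH}$-states are $(\hat s,q,b,M)$ with $\emptyset\ne M\subseteq\{\pi_1,\dots,\pi_k\}$. Initial states: $(\hat s,q_{\phi,0},\top^k)$ with $\mathit{pred}(\hat s)\wedge\bigwedge_{i=1}^k\mathit{init}_{\langle\pi_i\rangle}$ satisfiable. Bad states: those with $q\in B_\phi$. Transitions: (1) $(\hat s,q,b)\to(\hat s,q,b,M)$ if for all $\pi_i\in M$, $\neg b[i]\vee\neg\mathit{obs}(\hat s)[i]$; (2) $(\hat s,q,\top^k)\to(\hat s,\delta_\phi(q,\hat s),\bot^k)$ if $\mathit{obs}(\hat s)=\top^k$; (3) $(\hat s,q,b,M)\to(\hat s',q,b')$ if $\hat s\xrightarrow{M}\hat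 s'$ and $b'$ is $b$ with $b'[i]=\top$ for every $\pi_i\in M$. *)

(* Defs.v *)
From Stdlib Require List.
From mathcomp Require Import all_boot.
From mathcomp Require Import boolp.
From mathcomp Require classical_sets.

Set Implicit Arguments.
Unset Strict Implicit.
Unset Printing Implicit Defensive.

Record signature : Type := Signature {
  fsym : Type;
  farity : fsym -> nat;
  rsym : Type;
  rarity : rsym -> nat
}.

Inductive term (Sg : signature) (V : Type) : Type :=
| TVar of V
| TApp (f : fsym Sg) of 'I_(farity f) -> term Sg V.
Arguments TVar {Sg V}.
Arguments TApp {Sg V}.

(* [form Sg V] is the type of first-order formulas with equality whose free
   variables are among V; under a quantifier, None is the bound variable. *)
Inductive form (Sg : signature) (V : Type) : Type :=
| FTrue
| FEq of term Sg V & term Sg V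
| FRel (r : rsym Sg) of 'I_(rarity r) -> term Sg V
| FNot of form Sg V
| FAnd of form Sg V & form Sg V
| FEx of form Sg (option V).
Arguments FTrue {Sg V}.
Arguments FEq {Sg V}.
Arguments FRel {Sg V}.
Arguments FNot {Sg V}.
Arguments FAnd {Sg V}.
Arguments FEx {Sg V}.

Fixpoint trename Sg V W (r : V -> W) (t : term Sg V) : term Sg W :=
  match t with
  | TVar v => TVar (r v)
  | TApp f ts => TApp f (fun i => trename r (ts i))
  end.

Fixpoint rename Sg V W (r : V -> W) (theta : form Sg V) : form Sg W :=
  match theta with
  | FTrue => FTrue
  | FEq t u => FEq (trename r t) (trename r u)
  | FRel s ts => FRel s (fun i => trename r (ts i))
  | FNot f => FNot (rename r f)
  | FAnd f g => FAnd (rename r f) (rename r g)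
  | FEx f => FEx (rename (option_map r) f)
  end.

Record structure (Sg : signature) : Type := Structure {
  carrier :> Type;
  carrier_inhabited : inhabited carrier;
  finterp : forall f : fsym Sg, ('I_(farity f) -> carrier) -> carrier;
  rinterp : forall r : rsym Sg, ('I_(rarity r) -> carrier) -> Prop
}.

Fixpoint teval Sg (M : structure Sg) V (mu : V -> M) (t : term Sg V) : M :=
  match t with
  | TVar v => mu v
  | TApp f ts => finterp (fun i => teval mu (ts i))
  end.

Fixpoint sat Sg (M : structure Sg) V (mu : V -> M) (theta : form Sg V) : Prop :=
  match theta with
  | FTrue => True
  | FEq t u => teval mu t = teval mu u
  | FRel r ts => rinterp (fun i => teval mu (ts i))
  | FNot f => ~ sat mu f
  | FAnd f g => sat mu f /\ sat mu g
  | FEx f => exists a : M, sat (fun v => if v is Some w then mu w else a) f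
  end.

(* A theory is given by its class of models: a singleton class fixes an
   intended interpretation, the class of all models of a set of axioms gives an
   axiomatic theory.  Satisfiability is truth in some model, equivalence and
   validity range over all models, and the states of one execution live in a
   single model. *)
Definition theory (Sg : signature) : Type := structure Sg -> Prop.

Section Theory.
Variables (Sg : signature) (Th : theory Sg).

Definition satisfiable V (theta : form Sg V) : Prop :=
  exists2 M : structure Sg, Th M & exists mu : V -> M, sat mu theta.

Definition equivalent V (f g : form Sg V) : Prop :=
  forall M : structure Sg, Th M -> forall mu : V -> M, sat mu f <-> sat mu g.

Inductive bool_comb V n (P : 'I_n -> form Sg V) : form Sg V -> Prop :=
| BC_pred i : bool_comb P (P i)
| BC_true : bool_comb P FTrue
| BC_not f : bool_comb P f -> bool_comb P (FNot f)
| BC_and f g : bool_comb P f -> bool_comb P g -> bool_comb P (FAnd f g).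

Definition expressible V n (P : 'I_n -> form Sg V) (theta : form Sg V) : Prop :=
  exists2 f, bool_comb P f & equivalent theta f.

End Theory.

(* In [X + X], inl x is the variable x and inr x its primed copy x'. *)
Record sts (Sg : signature) (X : finType) : Type := STS {
  init : form Sg X;
  step : form Sg (X + X)
}.

Definition trace Sg (M : structure Sg) (X : Type) : Type := nat -> X -> M.

Definition join_assign (V : Type) (D : Type) (mu mu' : V -> D) (v : V + V) : D :=
  match v with inl x => mu x | inr x => mu' x end.

Definition is_trace Sg (M : structure Sg) (X : finType) (T : sts Sg X)
    (t : trace M X) : Prop :=
  sat (t 0) (init T) /\
  forall i : nat, sat (join_assign (t i) (t i.+1)) (step T).

(* The indexed variable x_{pi_i} is the pair (i, x). *)
Definition pvar (k : nat) (X : Type) : Type := ('I_k * X)%type.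

Definition at_trace Sg X k (i : 'I_k) (theta : form Sg X) : form Sg (pvar k X) :=
  rename (fun x => (i, x)) theta.

Inductive ltl (A : Type) : Type :=
| LAtom of A
| LNot of ltl A
| LAnd of ltl A & ltl A
| LNext of ltl A
| LUntil of ltl A & ltl A.

Record ohyperltl (Sg : signature) (X : finType) (k : nat) : Type := OHyperLTL {
  obs_form : 'I_k -> form Sg X;
  body : ltl (form Sg (pvar k X))
}.

Section OHyperLTL.
Variables (Sg : signature) (X : finType) (k : nat).

Definition zip_at (M : structure Sg) (Pi : 'I_k -> trace M X) (i : nat) :
  pvar k X -> M := fun v => Pi v.1 i v.2.

Fixpoint ltl_sat (M : structure Sg) (Pi : 'I_k -> trace M X) (i : nat)
    (phi : ltl (form Sg (pvar k X))) : Prop :=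
  match phi with
  | LAtom theta => sat (zip_at Pi i) theta
  | LNot f => ~ ltl_sat Pi i f
  | LAnd f g => ltl_sat Pi i f /\ ltl_sat Pi i g
  | LNext f => ltl_sat Pi i.+1 f
  | LUntil f g => exists j : nat,
      [/\ i <= j, ltl_sat Pi j g & forall m, i <= m < j -> ltl_sat Pi m f]
  end.

Definition valid_obs (M : structure Sg) (t : trace M X) (xi : form Sg X) : Prop :=
  forall n : nat, exists2 j : nat, n <= j & sat (t j) xi.

(* j is the i-th observation point, counting from 0. *)
Definition nth_obs (M : structure Sg) (t : trace M X) (xi : form Sg X)
    (i j : nat) : Prop :=
  sat (t j) xi /\ count (fun m => `[< sat (t m) xi >]) (iota 0 j) = i.

(* The default index 0 of xget is only used if t has at most i observation
   points, which valid_obs excludes. *)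
Definition observe (M : structure Sg) (t : trace M X) (xi : form Sg X) :
  trace M X := fun i => t (classical_sets.xget 0 (nth_obs t xi i)).

Definition models (Th : theory Sg) (T : sts Sg X) (Phi : ohyperltl Sg X k) :
    Prop :=
  forall M : structure Sg, Th M ->
  forall t : 'I_k -> trace M X,
    (forall i, is_trace T (t i)) ->
    (forall i, valid_obs (t i) (obs_form Phi i)) ->
    ltl_sat (fun i => observe (t i) (obs_form Phi i)) 0 (body Phi).

End OHyperLTL.

Record edge (Q L : Type) : Type := Edge { src : Q; guard : L; dst : Q }.

(* A finite set of edges is a list, used only through membership. *)
Record automaton (Sg : signature) (V : Type) : Type := Automaton {
  aut_state : finType;
  aut_init : aut_state;
  aut_edges : seq (edge aut_state (form Sg V));
  aut_bad : {set aut_state}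
}.

Section Automaton.
Variables (Sg : signature) (Th : theory Sg) (V : Type) (A : automaton Sg V).

Definition is_run (M : structure Sg) (w : nat -> V -> M)
    (r : nat -> aut_state A) : Prop :=
  r 0 = aut_init A /\
  forall i : nat, exists theta : form Sg V,
    List.In (Edge (r i) theta (r i.+1)) (aut_edges A) /\ sat (w i) theta.

Definition accepts (M : structure Sg) (w : nat -> V -> M) : Prop :=
  forall r, is_run w r -> forall i : nat, r i \notin aut_bad A.

Definition deterministic : Prop :=
  forall (M : structure Sg), Th M -> forall (q : aut_state A) (mu : V -> M),
    exists! e, [/\ List.In e (aut_edges A), src e = q & sat mu (guard e)].

End Automaton.

Definition safety_automaton_for Sg (X : finType) k (Th : theory Sg)
    (A : automaton Sg (pvar k X)) (phi : ltl (form Sg (pvar k X))) : Prop :=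
  forall M : structure Sg, Th M -> forall Pi : 'I_k -> trace M X,
    accepts A (zip_at Pi) <-> ltl_sat Pi 0 phi.

Record safety_game : Type := SafetyGame {
  safe_state : Type;
  reach_state : Type;
  game_init : safe_state + reach_state -> Prop;
  game_trans : safe_state + reach_state -> safe_state + reach_state -> Prop;
  game_bad : safe_state + reach_state -> Prop
}.

Section Game.
Variable G : safety_game.

Definition game_state : Type := (safe_state G + reach_state G)%type.

Definition is_play (p : nat -> game_state) : Prop :=
  game_init (p 0) /\ forall i : nat, game_trans (p i) (p i.+1).

Definition safe_strategy (sigma : safe_state G -> game_state) : Prop :=
  forall s, game_trans (inl s) (sigma s).

Definition compatible (sigma : safe_state G -> game_state)
    (p : nat -> game_state) : Prop :=
  forall (i : nat) (s : safe_state G), p i = inl s -> p i.+1 = sigma s.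

Definition safe_wins : Prop :=
  exists2 sigma, safe_strategy sigma &
    forall p, is_play p -> compatible sigma p -> forall i : nat, ~ game_bad (p i).

End Game.

Section Abstraction.
Variables (Sg : signature) (Th : theory Sg) (X : finType) (k n : nat).
Variables (T : sts Sg X) (Phi : ohyperltl Sg X k).
Variables (A : automaton Sg (pvar k X)) (P : 'I_n -> form Sg (pvar k X)).

Definition abs_state : Type := {ffun 'I_n -> bool}.

Definition pred_form (s : abs_state) : form Sg (pvar k X) :=
  \big[FAnd/FTrue]_(i < n) (if s i then P i else FNot (P i)).

(* In [pvar k X + pvar k X], inr is again the primed copy. *)
Definition step_at (i : 'I_k) : form Sg (pvar k X + pvar k X) :=
  rename (fun v : X + X =>
    match v with inl x => inl (i, x) | inr x => inr (i, x) end) (step T).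

Definition stutter_at (i : 'I_k) : form Sg (pvar k X + pvar k X) :=
  \big[FAnd/FTrue]_(x : X) FEq (TVar (inr (i, x))) (TVar (inl (i, x))).

Definition step_form (M : {set 'I_k}) : form Sg (pvar k X + pvar k X) :=
  \big[FAnd/FTrue]_(i < k) (if i \in M then step_at i else stutter_at i).

Definition abs_step (M : {set 'I_k}) (s1 s2 : abs_state) : Prop :=
  satisfiable Th (FAnd (FAnd (rename inl (pred_form s1))
                             (rename inr (pred_form s2)))
                       (step_form M)).

Definition obs (s : abs_state) : {ffun 'I_k -> bool} :=
  [ffun i => `[< satisfiable Th
                   (FAnd (pred_form s) (at_trace i (obs_form Phi i))) >]].

(* The graph of the partial function (q, s) |-> delta_phi(q, s). *)
Definition is_delta (q : aut_state A) (s : abs_state) (q' : aut_state A) : Prop :=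
  unique (fun q1 => exists theta,
    List.In (Edge q theta q1) (aut_edges A) /\
    satisfiable Th (FAnd (pred_form s) theta)) q'.

Definition nonempty_set : Type := {M : {set 'I_k} | M != set0}.

Definition gsafe : Type :=
  (abs_state * aut_state A * {ffun 'I_k -> bool})%type.
Definition greach : Type :=
  (abs_state * aut_state A * {ffun 'I_k -> bool} * nonempty_set)%type.

Definition all_true : {ffun 'I_k -> bool} := [ffun=> true].
Definition all_false : {ffun 'I_k -> bool} := [ffun=> false].

Definition set_moved (b : {ffun 'I_k -> bool}) (M : {set 'I_k}) :
  {ffun 'I_k -> bool} := [ffun i => (i \in M) || b i].

Inductive ginit : gsafe + greach -> Prop :=
| Ginit s :
    satisfiable Th (FAnd (pred_form s)
      (\big[FAnd/FTrue]_(i < k) at_trace i (init T))) ->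
    ginit (inl (s, aut_init A, all_true)).

Inductive gtrans : gsafe + greach -> gsafe + greach -> Prop :=
| Gschedule s q (b : {ffun 'I_k -> bool}) (M : nonempty_set) :
    (forall i, i \in val M -> ~~ b i || ~~ obs s i) ->
    gtrans (inl (s, q, b)) (inr (s, q, b, M))
| Gobserve s q q' :
    obs s = all_true -> is_delta q s q' ->
    gtrans (inl (s, q, all_true)) (inl (s, q', all_false))
| Gmove s q (b : {ffun 'I_k -> bool}) (M : nonempty_set) s' :
    abs_step (val M) s s' ->
    gtrans (inr (s, q, b, M)) (inl (s', q, set_moved b (val M))).

Definition gbad (g : gsafe + greach) : Prop :=
  match g with
  | inl (_, q, _) => q \in aut_bad A
  | inr (_, q, _, _) => q \in aut_bad A
  end.

Definition game_forall : safety_game := SafetyGame ginit gtrans gbad.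

End Abstraction.

(* Main.v *)
(** A winning strategy is played against the scheduler that replays given
    concrete traces: a configuration pairs the game state with the positions
    reached in the traces and the number of joint observations so far.  The
    abstract state is always the abstraction of the concrete assignment, and
    expressibility of the observation formulas makes abstract and concrete
    observation points coincide.  Hence trace [i] has passed exactly as many
    observation points as there were joint observations, and the automaton
    component follows the run on the observed traces.  No trace can move past
    its next observation point before the others reach theirs, while every
    scheduled move advances some trace; so every letter of the run is
    eventually read. *)
Require Import Defs.
From mathcomp Require Import all_boot.
From mathcomp Require Import boolp.
From mathcomp Require classical_sets.

Set Implicit Arguments.
Unset Strict Implicit.
Unset Printing Implicit Defensive.

(** * Evaluation of renamed formulas, conjunctions and Boolean combinations *)

Lemma teval_rename Sg (M : structure Sg) V W (r : V -> W) (mu : W -> M)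
    (t : term Sg V) : teval mu (trename r t) = teval (mu \o r) t.
Proof.
elim: t => [//|f ts IH] /=.
by congr finterp; apply/funext => i; exact: IH.
Qed.

Lemma sat_rename Sg (M : structure Sg) V (f : form Sg V) :
  forall W (r : V -> W) (mu : W -> M),
  sat mu (rename r f) <-> sat (mu \o r) f.
Proof.
elim: f => {V} [V|V t u|V s ts|V f IH|V f IHf g IHg|V f IH] W r mu //=.
- by rewrite !teval_rename.
- rewrite (_ : (fun i => _) = (fun i => teval (mu \o r) (ts i))) //.
  by apply/funext => i; exact: teval_rename.
- by rewrite IH.
- by rewrite IHf IHg.
- split=> -[a fa]; exists a; move: fa; rewrite IH;
    set m := (X in sat X f); set m' := (X in _ -> sat X f);
    by rewrite (_ : m = m') //; apply/funext => -[].
Qed.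

Lemma sat_big_and Sg (M : structure Sg) V (mu : V -> M) (I : finType)
    (F : I -> form Sg V) :
  sat mu (\big[FAnd/FTrue]_i F i) <-> forall i, sat mu (F i).
Proof.
suff sat_seq (r : seq I) :
    sat mu (\big[FAnd/FTrue]_(i <- r) F i) <->
    forall i, i \in r -> sat mu (F i).
  rewrite sat_seq; split=> H i; last by move=> _.
  by apply: H; rewrite mem_index_enum.
elim: r => [|j r IH]; first by rewrite big_nil.
rewrite big_cons /= IH; split=> [[Fj Fr] i|H].
  by rewrite inE => /predU1P[->|/Fr].
by split=> [|i ir]; apply: H; rewrite inE ?eqxx ?ir ?orbT.
Qed.

Lemma sat_at_trace Sg (M : structure Sg) X k (i : 'I_k) (mu : pvar k X -> M)
    (theta : form Sg X) :
  sat mu (at_trace i theta) <-> sat (fun x => mu (i, x)) theta.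
Proof. exact: sat_rename. Qed.

(** Two models are allowed, since the satisfiability in [obs] may be witnessed in a model other than
    that of the traces. *)
Lemma sat_bool_comb Sg V n (P : 'I_n -> form Sg V) (f : form Sg V)
    (M N : structure Sg) (mu : V -> M) (nu : V -> N) :
  (forall i, sat mu (P i) <-> sat nu (P i)) ->
  bool_comb P f -> sat mu f <-> sat nu f.
Proof.
by move=> eqP; elim=> //= [g _ ->|g h _ -> _ ->].
Qed.

(** * Counting observation points *)

Lemma count_iotaS (a : pred nat) j :
  count a (iota 0 j.+1) = count a (iota 0 j) + a j.
Proof. by rewrite -addn1 iotaD count_cat /= addn0. Qed.

Lemma leq_count_iota (a : pred nat) i j :
  i <= j -> count a (iota 0 i) <= count a (iota 0 j).
Proof. by move=> /subnKC <-; rewrite iotaD count_cat leq_addr. Qed.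

(** Passing an observation point strictly increases the count. *)
Lemma nth_obs_inj Sg (X : finType) (M : structure Sg) (t : trace M X) xi c i j :
  nth_obs t xi c i -> nth_obs t xi c j -> i = j.
Proof.
move=> [xi_i ci] [xi_j cj].
have H l m : sat (t l) xi -> l < m ->
    count (fun m => `[< sat (t m) xi >]) (iota 0 l) <
    count (fun m => `[< sat (t m) xi >]) (iota 0 m).
  move=> xi_l /(leq_count_iota (fun m => `[< sat (t m) xi >])).
  by rewrite count_iotaS (asboolT xi_l) addn1.
case: (ltngtP i j) => // [/(H _ _ xi_i)|/(H _ _ xi_j)]; by rewrite ci cj ltnn.
Qed.

Lemma observeE Sg (X : finType) (M : structure Sg) (t : trace M X) xi c j :
  nth_obs t xi c j -> observe t xi c = t j.
Proof.
move=> cj; rewrite /observe.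
by rewrite (nth_obs_inj (classical_sets.xgetPex 0 (ex_intro _ j cj)) cj).
Qed.

Lemma valid_obs_unbounded Sg (X : finType) (M : structure Sg) (t : trace M X) xi m :
  valid_obs t xi ->
  exists j, m <= count (fun m => `[< sat (t m) xi >]) (iota 0 j).
Proof.
move=> valid_t; elim: m => [|m [j mj]]; first by exists 0.
have [l jl xi_l] := valid_t j; exists l.+1.
by rewrite count_iotaS (asboolT xi_l) addn1 ltnS (leq_trans mj) ?leq_count_iota.
Qed.

(** * Abstractions of concrete snapshots *)

Section Simulation.
Variables (Sg : signature) (Th : theory Sg) (X : finType) (k n : nat).
Variables (T : sts Sg X) (Phi : ohyperltl Sg X k).
Variables (A : automaton Sg (pvar k X)) (P : 'I_n -> form Sg (pvar k X)).
Hypothesis P_obs : forall i, expressible Th P (at_trace i (obs_form Phi i)).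
Variables (M : structure Sg) (ThM : Th M) (t : 'I_k -> trace M X).
Hypothesis t_trace : forall i, is_trace T (t i).
Hypothesis t_valid : forall i, valid_obs (t i) (obs_form Phi i).

Let G := game_forall Th T Phi A P.

Definition abstraction (N : structure Sg) (mu : pvar k X -> N) : abs_state n :=
  [ffun i => `[< sat mu (P i) >]].

Lemma sat_pred_form (N : structure Sg) (mu : pvar k X -> N) s :
  sat mu (pred_form P s) <-> s = abstraction mu.
Proof.
rewrite sat_big_and; split=> [H|-> i].
  apply/ffunP => i; rewrite ffunE; have := H i.
  by case: (s i) => /= [/asboolT ->|/asboolF ->].
by rewrite ffunE; case: asboolP.
Qed.

Definition snapshot (pos : 'I_k -> nat) : pvar k X -> M :=
  fun v => t v.1 (pos v.1) v.2.

Definition move_by (D : {set 'I_k}) (pos : 'I_k -> nat) : 'I_k -> nat :=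
  fun i => pos i + (i \in D).

(** By expressibility, the truth of the observation formula depends only on the abstract state, so a
    witness in any model decides it at the snapshot. *)
Lemma obs_snapshot pos i :
  obs Th Phi P (abstraction (snapshot pos)) i =
  `[< sat (t i (pos i)) (obs_form Phi i) >].
Proof.
rewrite ffunE; apply: asbool_equiv_eq; split; last first.
  move=> xi_i; exists M => //; exists (snapshot pos).
  by split; [rewrite sat_pred_form | rewrite sat_at_trace].
case=> N ThN [nu [/sat_pred_form absE xi_nu]].
have [f fP eqf] := P_obs i.
apply/(sat_at_trace i (snapshot pos)); apply/eqf => //.
move: xi_nu => /(eqf N ThN); apply: (sat_bool_comb _ fP).1 => j.
move/ffunP/(_ j): absE; rewrite !ffunE => absE.
by split=> /asboolT nuP; apply/asboolP; [rewrite absE | rewrite -absE].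
Qed.

(** The two snapshots are themselves a satisfying assignment: traces in [D] take a step of [T], the
    others stutter. *)
Lemma abs_step_snapshot (D : {set 'I_k}) pos :
  abs_step Th T P D (abstraction (snapshot pos))
    (abstraction (snapshot (move_by D pos))).
Proof.
exists M => //.
exists (join_assign (snapshot pos) (snapshot (move_by D pos))); split.
  by split; apply/sat_rename/sat_pred_form.
apply/sat_big_and => i; case: ifPn => iD; last first.
  by apply/sat_big_and => x /=; rewrite /snapshot /move_by (negPf iD) addn0.
apply/sat_rename; have := (t_trace i).2 (pos i).
set m := (Y in sat Y _); set m' := (Y in _ -> sat Y _).
rewrite (_ : m = m') //; apply/funext => -[x|x] //=.
by rewrite /m /m' /= /snapshot /move_by /= iD addn1.
Qed.

Lemma ginit_snapshot :
  game_init (s := G)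
    (inl (abstraction (snapshot (fun=> 0)), aut_init A, all_true k)).
Proof.
constructor; exists M => //; exists (snapshot (fun=> 0)).
split; first exact/sat_pred_form.
by apply/sat_big_and => i; apply/sat_at_trace; exact: (t_trace i).1.
Qed.

(** * The replayed play and its invariant *)

Record config := Config {
  game_pos : game_state G;
  trace_pos : 'I_k -> nat;
  obs_count : nat
}.

Variable sigma : safe_state G -> game_state G.
Hypothesis sigma_strategy : safe_strategy sigma.
Variable r : nat -> aut_state A.
Hypothesis r_run : is_run (zip_at (fun i => observe (t i) (obs_form Phi i))) r.

(** Only a joint observation leads from a [SAFE] state to a [SAFE] state, so the side of [sigma s]
    tells when to count. *)
Definition next (c : config) : config :=
  match game_pos c with
  | inl s => Config (sigma s) (trace_pos c)
               (if sigma s is inl _ then (obs_count c).+1 else obs_count c)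
  | inr (_, q, b, D) =>
      let pos := move_by (val D) (trace_pos c) in
      Config (inl (abstraction (snapshot pos), q, set_moved b (val D))) pos
        (obs_count c)
  end.

Definition start : config :=
  Config (inl (abstraction (snapshot (fun=> 0)), aut_init A, all_true k))
    (fun=> 0) 0.

(* [b i] false means that the observation point at [pos i] has already been
   used, so that it has to be counted. *)
Definition faithful (pos : 'I_k -> nat) (c : nat) (st : gsafe n A) : Prop :=
  let: (s, q, b) := st in
  [/\ s = abstraction (snapshot pos), q = r c &
      forall i, count (fun m => `[< sat (t i m) (obs_form Phi i) >])
                  (iota 0 (pos i + ~~ b i)) = c].

Definition invariant (c : config) : Prop :=
  match game_pos c with
  | inl st => faithful (trace_pos c) (obs_count c) st
  | inr (s, q, b, D) => faithful (trace_pos c) (obs_count c) (s, q, b) /\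
      forall i, i \in val D -> ~~ b i || ~~ obs Th Phi P s i
  end.

Lemma invariant_start : invariant start.
Proof.
split=> [//||i]; first by rewrite r_run.1.
by rewrite ffunE.
Qed.

Lemma faithful_observe s q q' pos c :
  obs Th Phi P s = all_true k -> is_delta Th P q s q' ->
  faithful pos c (s, q, all_true k) ->
  faithful pos c.+1 (s, q', all_false k).
Proof.
move=> obs_s [_ q'_uniq] [sE qE cnt].
have xi_pos i : sat (t i (pos i)) (obs_form Phi i).
  by apply/asboolP; rewrite -obs_snapshot -sE obs_s ffunE.
have {}cnt i : count (fun m => `[< sat (t i m) (obs_form Phi i) >])
                 (iota 0 (pos i)) = c by rewrite -[RHS](cnt i) ffunE addn0.
split=> // [|i].
  have [theta [theta_edge sat_theta]] := r_run.2 c.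
  (* The edge taken by the run is satisfied at the snapshot, so uniqueness of the abstract successor
     forces [q'] to be the next state of the run. *)
  apply: q'_uniq; exists theta; split; first by rewrite qE.
  exists M => //; exists (snapshot pos); split; first exact/sat_pred_form.
  move: sat_theta; set m := (Y in sat Y _).
  rewrite (_ : m = snapshot pos) //; apply/funext => -[i x] /=.
  (* By [cnt], [pos i] is observation point number [c] of trace [i]. *)
  by rewrite /m /zip_at /= (@observeE _ _ _ _ _ _ (pos i)).
by rewrite ffunE addn1 count_iotaS cnt (asboolT (xi_pos i)) addn1.
Qed.

Lemma faithful_move s q (b : {ffun 'I_k -> bool}) (D : {set 'I_k}) pos c :
  (forall i, i \in D -> ~~ b i || ~~ obs Th Phi P s i) ->
  faithful pos c (s, q, b) ->
  faithful (move_by D pos) c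
    (abstraction (snapshot (move_by D pos)), q, set_moved b D).
Proof.
move=> sched [sE qE cnt]; split=> // i.
rewrite ffunE /move_by; have := cnt i; have := sched i.
case: (i \in D) => /=; last by rewrite addn0.
move/(_ isT); rewrite sE obs_snapshot => + <-.
(* If [b i] holds, the position left behind is no observation point; otherwise it was already
   counted. *)
case: (b i) => /= [/negPf not_xi|_]; last by rewrite addn0.
by rewrite !addn0 addn1 count_iotaS not_xi addn0.
Qed.

Lemma invariant_next c :
  invariant c ->
  game_trans (s := G) (game_pos c) (game_pos (next c)) /\ invariant (next c).
Proof.
case: c => [[st|[[[s q] b] D]] pos c]; rewrite /invariant /next /=; last first.
  move=> [faith sched]; split; last exact: faithful_move sched faith.
  by case: faith => -> _ _; constructor; exact: abs_step_snapshot.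
have trans := sigma_strategy st => faith; split=> //.
inversion trans as [s q b D sched sE|s q q' obs_s delta sE|]; subst=> //.
exact: faithful_observe faith.
Qed.

Lemma invariant_iter N : invariant (iter N next start).
Proof.
by elim: N => [|N /invariant_next[]//]; exact: invariant_start.
Qed.

(** * Progress of the play *)

(* An upper bound on the length of the play so far: each of its steps is a
   joint observation or half of a scheduled move, which advances some trace. *)
Definition moves (c : config) : nat :=
  (\sum_i trace_pos c i).*2 + obs_count c + (if game_pos c is inl _ then 0 else 1).

Lemma moves_next c : moves c < moves (next c).
Proof.
case: c => [[st|[[[s q] b] D]] pos c]; rewrite /moves /next /=.
  by case: (sigma st) => _; rewrite !(addn0, addn1, addnS).
have [i iD] := set0Pn _ (valP D).
suff lt_pos : \sum_i pos i < \sum_i move_by (val D) pos i.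
  by rewrite addn0 addn1 -!addSn leq_add2r -doubleS leq_double.
rewrite big_split /= -[X in X < _]addn0 ltn_add2l.
by rewrite (bigD1 i) //= iD.
Qed.

(** If the count stayed below [m], no trace could pass its first [m] observation points, which would
    bound [moves]. *)
Lemma obs_count_unbounded m : exists N, m <= obs_count (iter N next start).
Proof.
have late N : N <= moves (iter N next start).
  by elim: N => // N IH; exact: leq_ltn_trans IH (moves_next _).
have /choice[J mJ] i := valid_obs_unbounded m (@t_valid i).
have [//|stuck] := pselect (exists N, m <= obs_count (iter N next start)).
(* Exceeds [moves] when each position is at most [J i] and the count is below [m]. *)
pose N := ((\sum_i J i).*2 + m).+2.
have cm : obs_count (iter N next start) < m.
  by rewrite ltnNge; apply/negP => mc; apply: stuck; exists N.
have [b cnt] : exists b : {ffun 'I_k -> bool}, forall i,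
    count (fun m => `[< sat (t i m) (obs_form Phi i) >])
      (iota 0 (trace_pos (iter N next start) i + ~~ b i)) =
    obs_count (iter N next start).
  have := invariant_iter N; rewrite /invariant.
  case: (game_pos _) => [[[s q] b] [_ _]|[[[s q] b] D] [[_ _]]];
    by exists b.
have le_pos : \sum_i trace_pos (iter N next start) i <= \sum_i J i.
  apply: leq_sum => i _; rewrite leqNgt; apply/negP => Jpos.
  have Jpos_b := leq_trans (ltnW Jpos) (leq_addr (~~ b i) _).
  have := leq_trans (mJ i) (leq_count_iota _ Jpos_b).
  by rewrite cnt leqNgt cm.
suff: moves (iter N next start) < N by rewrite ltnNge late.
rewrite /moves {4}/N ltnS -addnA -addnS leq_add ?leq_double //.
by case: (game_pos _) => _; apply: leqW; rewrite ?addn1 // addn0 ltnW.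
Qed.

Hypothesis sigma_wins : forall p, is_play (G := G) p -> compatible sigma p ->
  forall i, ~ game_bad (p i).

Lemma run_safe m : r m \notin aut_bad A.
Proof.
have safe N : r (obs_count (iter N next start)) \notin aut_bad A.
  have: ~ game_bad (game_pos (iter N next start)).
    apply: (sigma_wins (p := fun N => game_pos (iter N next start))).
      split=> [|i]; first exact: ginit_snapshot.
      by case: (invariant_next (invariant_iter i)).
    by move=> i s pi; rewrite iterS /next pi.
  have := invariant_iter N; rewrite /invariant.
  by case: (game_pos _) => [[[s q] b] [_ -> _]|[[[s q] b] D] [[_ -> _] _]] /negP.
have [N] := obs_count_unbounded m.
(* The count grows by at most one per step, so it takes the value [m] exactly. *)
elim: N => [|N IH]; first by rewrite leqn0 => /eqP ->; exact: (safe 0).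
rewrite leq_eqVlt => /predU1P[->|]; first exact: (safe N.+1).
rewrite iterS /next; case: (game_pos _) => [s|[[[s q] b] D]] /=.
  by case: (sigma s) => _ => [/IH|/ltnW/IH].
by move=> /ltnW/IH.
Qed.

End Simulation.

Theorem theorem2 (Sg : signature) (Th : theory Sg) (X : finType) (k n : nat)
    (T : sts Sg X) (Phi : ohyperltl Sg X k)
    (A : automaton Sg (pvar k X))
    (A_det : deterministic Th A)
    (A_body : safety_automaton_for Th A (body Phi))
    (P : 'I_n -> form Sg (pvar k X))
    (P_edges : forall e, List.In e (aut_edges A) -> expressible Th P (guard e))
    (P_init : forall i : 'I_k, expressible Th P (at_trace i (init T)))
    (P_obs : forall i : 'I_k, expressible Th P (at_trace i (obs_form Phi i))) :
  safe_wins (game_forall Th T Phi A P) -> models Th T Phi.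
Proof.
move=> [sigma sigma_strategy sigma_wins] M ThM t t_trace t_valid.
apply/A_body => // r r_run.
exact: (run_safe P_obs ThM t_trace t_valid sigma_strategy r_run sigma_wins).
Qed.
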